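(* There is an absolute constant $c>0$ such that for every $n\in\mathbb N$ with $n\ge 2$ there exists an $n$-point metric space $\mathcal M$ with $C_{\mathrm{rand}}^{\mathrm{MSS}}(\mathcal M,n-1)\ge c\log^2 n$. That is, $C_{\mathrm{rand}}^{\mathrm{MSS}}(\mathcal M,n-1)=\Omega(\log^2 n)$.
   Context: Small set chasing (metrical service systems), MSS: given a metric space $\mathcal M=(M,d)$, a starting point $x_0\in M$ and $w\in\mathbb N$, an adversary presents online a sequence of requests, each a nonempty subset of $M$ of cardinality at most $w$; upon receiving a request the algorithm must move its (single) server to some point of that subset, paying the distance travelled. The cost of an algorithm on a request sequence is its total movement; $c_{\mathrm{opt}}(\rho)$ is the minimum cost over all (offline) ways of serving $\rho$. A randomized online algorithm is a probability distribution over deterministic online algorithms. The randomized competitive ratio $C_{\mathrm{rand}}^{\mathrm{MSS}}(\mathcal M,w)$ is the infimum of all $C$ for which there exist a randomized online algorithm $\tilde A$ and a constant $\kappa$ such that for every request sequence $\rho$, $\mathbb E_{A\sim\tilde A}[c_A(\rho)]\le C\cdot c_{\mathrm{opt}}(\rho)+\kappa$. *)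

(* Defs.v *)
From HB Require Import structures.
From mathcomp Require Import all_boot all_order all_algebra finmap.
From mathcomp Require Import all_classical all_reals all_analysis.

Set Implicit Arguments.
Unset Strict Implicit.
Unset Printing Implicit Defensive.

Import Order.TTheory GRing.Theory Num.Theory.

Local Open Scope classical_set_scope.
Local Open Scope ring_scope.

Section MetricalServiceSystems.
Context {R : realType} {M : metricType R}.
Implicit Types (x : M) (w : nat).

Definition request w :=
  {r : {fset M} | (r != fset0)%fset && (#|` r|%fset <= w)%N}.

Definition movement (x : M) (s : seq M) : R :=
  \sum_(l <- pairmap (@mdist R M) x s) l.

Definition serves w (rho : seq (request w)) (s : seq M) : bool :=
  all2 (fun x (r : request w) => x \in val r) s rho.

(* The infimum is over finitely many schedules, at least one: a minimum. *)
Definition opt_cost x0 w (rho : seq (request w)) : R :=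
  inf [set movement x0 s | s in [set s | serves rho s]].

(* A deterministic online algorithm gives the position of the server as a
   function of the requests received so far. *)
Record online_algorithm x0 w := OnlineAlgorithm {
  position :> seq (request w) -> M ;
  position_nil : position [::] = x0 ;
  position_rcons : forall rho r, position (rcons rho r) \in val r }.

Definition trajectory x0 w (A : online_algorithm x0 w) (rho : seq (request w))
  : seq M := [seq A (take i.+1 rho) | i <- iota 0 (size rho)].

Definition alg_cost x0 w (rho : seq (request w)) (A : online_algorithm x0 w)
  : R := movement x0 (trajectory A rho).

Lemma request_inhabited w (r : request w) : exists x, x \in val r.
Proof. by case: r => r /= /andP[/fset0Pn]. Qed.

(* Some online algorithm; measurable types have to be inhabited. *)
Definition default_algorithm x0 w : online_algorithm x0 w.
Proof.
exists (fun rho => last x0 [seq xchoose (request_inhabited r) | r <- rho]).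
  by [].
by move=> rho r; rewrite map_rcons last_rcons; exact: xchooseP.
Defined.

HB.instance Definition _ x0 w := gen_eqMixin (online_algorithm x0 w).
HB.instance Definition _ x0 w := gen_choiceMixin (online_algorithm x0 w).
HB.instance Definition _ x0 w :=
  isPointed.Build (online_algorithm x0 w) (default_algorithm x0 w).

(* As A rho ranges over a finite set when rho is fixed, these events generate
   the product sigma-algebra, i.e. the one that makes all decisions
   measurable. *)
Definition decision_events x0 w : set (set (online_algorithm x0 w)) :=
  [set E | exists rho x, E = [set A : online_algorithm x0 w | A rho = x]].

Definition algorithm_space x0 w := g_sigma_algebraType (@decision_events x0 w).

Definition randomized_algorithm x0 w := probability (algorithm_space x0 w) R.

Definition competitive x0 w (P : randomized_algorithm x0 w) (C : R) :=
  exists kappa : R, forall rho : seq (request w),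
    ('E_P[@alg_cost x0 w rho] <= (C * opt_cost x0 rho + kappa)%:E)%E.

(* Equal to +oo when no randomized algorithm is competitive. *)
Definition C_rand_MSS x0 w : \bar R :=
  ereal_inf [set C%:E | C in
    [set C : R | exists P : randomized_algorithm x0 w, competitive P C]].

End MetricalServiceSystems.

(* Main.v *)
Require Import Defs.
From HB Require Import structures.
From mathcomp Require Import all_boot all_order all_algebra finmap.
From mathcomp Require Import all_classical all_reals all_analysis.
From mathcomp Require Import measurable_realfun lra.

Set Implicit Arguments.
Unset Strict Implicit.
Unset Printing Implicit Defensive.

Import Order.TTheory GRing.Theory Num.Theory.

Local Open Scope classical_set_scope.
Local Open Scope ring_scope.

(* A pass of level [k] is a random request sequence that drives the server from
   one end of a diamond-like space to the other, while a clairvoyant server only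
   pays the length of a geodesic. Suppose that passes of level [k] cost an online
   server [C] per unit of length. In the middle third of the space of level
   [k + 1] there are two branches, far from each other, each with a copy of the
   space of level [k]. Fair coins decide which of the two branches advances in
   its pass, by pieces that cost about as much as changing branches, so that
   nothing is gained by changing. After about [C] coins one branch has a lead of
   order [sqrt C] pieces; it is then closed, and the other branch, which still
   has more to come, completes its pass. The clairvoyant server pays nothing
   extra, but the online server pays [C + c sqrt C] per unit of length. Hence
   the ratio is of order [k ^ 2] at level [k], with [5 * 6 ^ k] points. *)

(** * Fair races *)

Section Walk.
Context {R : rcfType}.

(* The mean of the positive part of [i - j] after [n] more fair coins, each of
   which increments [i] or [j]. *)
Fixpoint lead n i j : R :=
  if n is m.+1 then (lead m i.+1 j + lead m i j.+1) / 2
  else if (j <= i)%N then i%:R - j%:R else 0.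

(** By symmetry [lead n j i] is the mean of the negative part of [i - j], and fair coins preserve
    the mean of [i - j]. *)
Lemma lead_skew n i j : lead n i j - lead n j i = i%:R - j%:R.
Proof.
elim: n i j => [|n IH] i j /=.
  case: (leqP j i) (leqP i j) => [ji|ij] [ij'|ji'] /=; try lra.
    have -> : i = j by apply/eqP; rewrite eqn_leq ij' ji.
    by rewrite !subrr.
  by have := ltn_trans ij ji'; rewrite ltnn.
by have := IH i.+1 j; have := IH i j.+1; rewrite -(natr1 i) -(natr1 j); lra.
Qed.

Lemma lead_incl n i j : lead n i j <= lead n i.+1 j <= lead n i j + 1.
Proof.
elim: n i j => [|n IH] i j /=; last first.
  by have := IH i.+1 j; have := IH i j.+1; lra.
rewrite -(natr1 i); case: (leqP j i) => [ji|ij].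
  by rewrite (leqW ji); lra.
case: (leqP j i.+1) => [ji|_]; last by lra.
have -> : j = i.+1 by apply/eqP; rewrite eqn_leq ji ij.
by rewrite -(natr1 i); lra.
Qed.

Lemma lead_incr n i j : lead n i j.+1 <= lead n i j <= lead n i j.+1 + 1.
Proof.
have := lead_incl n j i; have := lead_skew n i j; have := lead_skew n i j.+1.
by rewrite -(natr1 j); lra.
Qed.

Lemma lead_turn n i j : lead n i j.+1 <= lead n i.+1 j <= lead n i j.+1 + 2.
Proof. by have := lead_incl n i j; have := lead_incr n i j; lra. Qed.

(* [2 * lead n i j - (i - j)] is the mean of [|q|] after [n] steps of a simple
   random walk started at [q = i - j]; it is compared with the moments of order
   2 and 4 through [s q ^ 2 - s ^ 3 q ^ 4 / 4 <= |q|]. *)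
Lemma lead_moments n i j (s : R) : 0 < s ->
  let q := i%:R - j%:R in
  s * (q ^+ 2 + n%:R)
    - s ^+ 3 / 4 * (q ^+ 4 + 6 * q ^+ 2 * n%:R + 3 * n%:R ^+ 2 - 2 * n%:R)
  <= 2 * lead n i j - q.
Proof.
move=> s0 /=; elim: n i j => [|n IH] i j; last first.
  (* The polynomials are the exact second and fourth moments after [n] steps, hence the means of
     their values after the first coin. *)
  have h1 := IH i.+1 j; have h2 := IH i j.+1.
  rewrite -(natr1 i) in h1; rewrite -(natr1 j) in h2.
  apply: le_trans (_ : _ <= (2 * lead n i.+1 j - (i%:R + 1 - j%:R)
     + (2 * lead n i j.+1 - (i%:R - (j%:R + 1)))) / 2) _; last by rewrite /=; lra.
  rewrite -(natr1 n); set a : R := i%:R in h1 h2 *; set b : R := j%:R in h1 h2 *.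
  set m : R := n%:R in h1 h2 *.
  by move: h1 h2; set x := lead n i.+1 j; set y := lead n i j.+1; lra.
rewrite /= mulr0n !mulr0 !addr0 subr0 expr0n /= mulr0 addr0.
have key (q : R) : 0 <= q -> s * q ^+ 2 - s ^+ 3 / 4 * q ^+ 4 <= q.
  move=> q0; set r := s * q; have r0 : 0 <= r by rewrite mulr_ge0 // ltW.
  have -> : s * q ^+ 2 - s ^+ 3 / 4 * q ^+ 4 = q * (r - r ^+ 3 / 4).
    by rewrite /r; lra.
  rewrite -[leRHS]mulr1 ler_wpM2l //.
  (* Wanted is [r ^ 3 - 4 r + 4 >= 0]; for [r >= 0] the left side is least near [7 / 6]. *)
  have : 0 <= (r + 7 / 3) * (r - 7 / 6) ^+ 2 by rewrite mulr_ge0 ?sqr_ge0 //; lra.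
  by rewrite !exprS expr0; lra.
case: leqP => [ji|ij].
  have q0 : 0 <= i%:R - j%:R :> R by rewrite subr_ge0 ler_nat.
  by have := key _ q0; lra.
have q0 : 0 <= j%:R - i%:R :> R by rewrite subr_ge0 ler_nat ltnW.
have := key _ q0.
have -> : (j%:R - i%:R : R) ^+ 2 = (i%:R - j%:R) ^+ 2 by lra.
have -> : (j%:R - i%:R : R) ^+ 4 = (i%:R - j%:R) ^+ 4 by lra.
by lra.
Qed.

(** With [s = 1 / t] the second moment contributes [t / 3] and the fourth takes away at most
    [t / 12], which leaves [t / 4 <= 2 * lead n 0 0]. *)
Lemma lead_sqrt n (t : R) : 0 < t -> t ^+ 2 = 3 * n%:R -> t / 8 <= lead n 0 0.
Proof.
move=> t0 tn; have := @lead_moments n 0 0 t^-1; rewrite invr_gt0 => /(_ t0) /=.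
have -> : (n%:R : R) = t ^+ 2 / 3 by rewrite tn; lra.
rewrite subrr !expr0n /= !mulr0 mul0r !add0r subr0.
set L := lead n 0 0 => h.
have e1 : t^-1 * (t ^+ 2 / 3) = t / 3 by rewrite expr2 !mulrA mulVf ?mul1r ?gt_eqF.
have e2 : t^-1 ^+ 3 / 4 * (3 * (t ^+ 2 / 3) ^+ 2 - 2 * (t ^+ 2 / 3))
   = t / 12 - t^-1 / 6.
  have tV : t * t^-1 = 1 by rewrite mulfV ?gt_eqF.
  have -> : t^-1 ^+ 3 / 4 * (3 * (t ^+ 2 / 3) ^+ 2 - 2 * (t ^+ 2 / 3))
    = (t * t^-1) ^+ 3 * t / 12 - (t * t^-1) ^+ 2 * t^-1 / 6 by lra.
  by rewrite tV !expr1n !mul1r.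
have : 0 < t^-1 by rewrite invr_gt0.
by move: h; rewrite e1 e2; lra.
Qed.
End Walk.

(** * Random request sequences with a potential *)

Section Games.
Context {R : rcfType} {X : Type}.
Implicit Types (d : X -> X -> R) (gam : X -> R) (dom : X -> bool).

(* A state of a random request sequence: [cur] is the last request, [psi x] a
   lower bound on the expected cost still to come for an online server at [x],
   and [lam] a value close to [psi] that does not depend on [x], whose decrease
   measures the progress of the sequence. *)
Record node := Node { cur : X -> bool ; psi : X -> R ; lam : R }.

(** [Move] issues the request of the next state; [Coin] issues none and only decides how the
    sequence goes on. *)
Inductive game :=
| Stop of node
| Move of node & game
| Coin of node & game & game.

Definition entry g := match g with Stop n | Move n _ | Coin n _ _ => n end.

Fixpoint gcat g g' :=
  match g with
  | Stop n => Move n g'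
  | Move n h => Move n (gcat h g')
  | Coin n a b => Coin n (gcat a g') (gcat b g')
  end.

Lemma entry_gcat g g' : entry (gcat g g') = entry g.
Proof. by case: g. Qed.

Record node_ok d dom (E : R) n : Prop := NodeOk {
  node_ex : exists x, cur n x ;
  node_dom : forall x, cur n x -> dom x ;
  node_lip : forall x y, cur n x -> cur n y -> psi n x <= d x y + psi n y ;
  node_band : forall x, cur n x -> lam n - E <= psi n x <= lam n + E }.

(* [gam] bounds the offline cost: by [move_reach], every point [x] of the current
   request is reached by a clairvoyant server that has paid [gam x], up to a
   constant. *)
Record move_ok d gam (eta : R) n m : Prop := MoveOk {
  move_psi : forall x y, cur n x -> cur m y -> psi n x <= d x y + psi m y ;
  move_reach : forall y, cur m y -> exists2 x, cur n x & d x y <= gam y - gam x ;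
  move_lam : lam m <= lam n <= lam m + eta }.

Record coin_ok (eta : R) n a b : Prop := CoinOk {
  coin_curl : cur a =1 cur n ;
  coin_curr : cur b =1 cur n ;
  coin_psi : forall x, cur n x -> psi n x <= (psi a x + psi b x) / 2 ;
  coin_laml : lam a <= lam n <= lam a + eta ;
  coin_lamr : lam b <= lam n <= lam b + eta }.

Fixpoint valid d gam dom E eta (F : node -> Prop) g : Prop :=
  match g with
  | Stop n => node_ok d dom E n /\ F n
  | Move n h => [/\ node_ok d dom E n, move_ok d gam eta n (entry h)
                  & valid d gam dom E eta F h]
  | Coin n a b => [/\ node_ok d dom E n, coin_ok eta n (entry a) (entry b),
                      valid d gam dom E eta F a & valid d gam dom E eta F b]
  end.

Lemma valid_entry d gam dom E eta F g :
  valid d gam dom E eta F g -> node_ok d dom E (entry g).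
Proof. by case: g => [n|n h|n a b] /= []. Qed.

Lemma valid_weaken d gam dom dom' E E' eta eta' (F F' : node -> Prop) g :
  (forall x, dom x -> dom' x) -> E <= E' -> eta <= eta' ->
  (forall n, F n -> F' n) ->
  valid d gam dom E eta F g -> valid d gam dom' E' eta' F' g.
Proof.
move=> sd sE se sF.
have nW n : node_ok d dom E n -> node_ok d dom' E' n.
  case=> h1 h2 h3 h4; split=> // x nx; first exact/sd/h2.
  by have := h4 x nx; lra.
elim: g => [n|n h IH|n a IHa b IHb] /=.
- by case=> /nW ? /sF.
- by case=> /nW ? [m1 m2 m3] /IH ?; split=> //; split=> //; lra.
- by case=> /nW ? [c1 c2 c3 c4 c5] /IHa ? /IHb ?; split=> //; split=> //; lra.
Qed.

Lemma valid_gcat d gam dom E eta (F F' : node -> Prop) g g' :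
  valid d gam dom E eta F g -> valid d gam dom E eta F' g' ->
  (forall n, node_ok d dom E n -> F n -> move_ok d gam eta n (entry g')) ->
  valid d gam dom E eta F' (gcat g g').
Proof.
move=> vg vg' FF; elim: g vg => [n|n h IH|n a IHa b IHb] /=.
- by case=> nn Fn; split=> //; apply: FF.
- by case=> nn mm /IH vh; rewrite entry_gcat.
- by case=> nn cc /IHa va /IHb vb; rewrite !entry_gcat.
Qed.

End Games.
Arguments node : clear implicits.
Arguments game : clear implicits.

(** * Transport of a random sequence along a map of spaces *)

Section Pull.
Context {R : rcfType} {X Y : Type} (dom : Y -> bool) (f : Y -> X) (a : R).

Definition pulln (n : node R X) : node R Y :=
  Node (fun y => dom y && cur n (f y)) (fun y => psi n (f y) + a) (lam n + a).

Fixpoint pull g :=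
  match g with
  | Stop n => Stop (pulln n)
  | Move n h => Move (pulln n) (pull h)
  | Coin n b c => Coin (pulln n) (pull b) (pull c)
  end.

Lemma entry_pull g : entry (pull g) = pulln (entry g).
Proof. by case: g. Qed.

(** Online bounds survive since [f] does not increase distances; offline moves survive since each
    lifts, with prescribed end, to one that is no longer. *)
Lemma valid_pull (d : X -> X -> R) gam (d' : Y -> Y -> R) gam' k E eta
    (F : node R X -> Prop) (F' : node R Y -> Prop) g :
  (forall y z, dom y -> dom z -> d (f y) (f z) <= d' y z) ->
  (forall y x, dom y -> exists2 z, dom z /\ f z = x & d' z y <= d x (f y)) ->
  (exists y, dom y) ->
  (forall y, dom y -> gam' y = gam (f y) + k) ->
  (forall n, F n -> F' (pulln n)) ->
  valid d gam predT E eta F g -> valid d' gam' dom E eta F' (pull g).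
Proof.
move=> dd lift [y0 y0d] gg sF.
have nP n : node_ok d predT E n -> node_ok d' dom E (pulln n).
  case=> [[x nx] _ h3 h4]; split=> /=.
  - by have [z [zd zx] _] := lift _ x y0d; exists z; rewrite zd zx.
  - by move=> y /andP[].
  - move=> y z /andP[yd ny] /andP[zd nz].
    by have := h3 _ _ ny nz; have := dd _ _ yd zd; lra.
  - by move=> y /andP[_ /h4]; lra.
elim: g => [n|n h IH|n b IHb c IHc] /=.
- by case=> /nP ? /sF.
- case=> /nP ? [m1 m2 m3] /IH ?; rewrite entry_pull; split=> //; split=> /=.
  + move=> y z /andP[yd ny] /andP[zd nz].
    by have := m1 _ _ ny nz; have := dd _ _ yd zd; lra.
  + move=> y /andP[yd /m2[x nx dx]]; have [z [zd zx] dz] := lift _ x yd.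
    exists z; first by rewrite zd zx.
    by rewrite (le_trans dz) // !gg // zx; lra.
  + lra.
- case=> /nP ? [c1 c2 c3 c4 c5] /IHb ? /IHc ?; rewrite !entry_pull; split=> //.
  split=> /=; [move=> y|move=> y|move=> y /andP[_ /c3]| |]; try lra.
  + by rewrite c1.
  + by rewrite c2.
Qed.
End Pull.

(** * The race between two distant branches *)

Section Race.
Context {R : rcfType} {X : Type} (d : X -> X -> R) (gam : X -> R).
Context (domL domR : X -> bool) (E eta D gap V B : R).
Context (FL FR F : node R X -> Prop) (finL finR : game R X).
Hypothesis dxx : forall x, d x x = 0.
Hypothesis disj : forall x, domL x -> domR x -> False.
Hypothesis gapLR : forall x y, domL x -> domR y -> gap <= d x y.
Hypothesis gapRL : forall x y, domL x -> domR y -> gap <= d y x.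
Hypothesis gapE : 2 * E + D + eta <= gap.
Hypothesis E0 : 0 <= E.
Hypothesis eta0 : 0 <= eta.
Hypothesis etaD : eta <= D.
Hypothesis FLB : forall n, FL n -> lam n = B.
Hypothesis FRB : forall n, FR n -> lam n = B.
Hypothesis finLP : forall T, valid d gam domL E eta FL T ->
  valid d gam predT (E + D) D F (gcat T finL).
Hypothesis finRP : forall T, valid d gam domR E eta FR T ->
  valid d gam predT (E + D) D F (gcat T finR).

Local Ltac rlra := move: gapE E0 eta0 etaD; lra.

(* A race with [n] coins to go, after [i] and [j] pieces of size [D] in the left
   and right branch. A server on the left that stays there pays about [V - i D],
   plus the lead that the left branch has if it is closed at the end, since the
   right branch is that much behind. *)
Definition mix n i j (a b : node R X) : node R X :=
  Node (fun x => cur a x || cur b x)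
       (fun x => if domL x then psi a x + lead n i j * D
                 else psi b x + lead n j i * D)
       (V - i%:R * D + lead n i j * D).

(** A branch's counter is incremented before the piece is played: the branch starts about [D] above
    its mark and ends at most [eta] below it. *)
Definition on_track i (a : node R X) := V - i%:R * D - eta <= lam a <= V - i%:R * D + D.

(** In continuation style, because what is left of [T] at the threshold depends on the coins inside
    [T]; the branch later resumes from there. *)
Fixpoint run (mk : node R X -> node R X) th (T : game R X) k : game R X :=
  if lam (entry T) <= th then k T else
  match T with
  | Stop n => k T
  | Move n g => Move (mk n) (run mk th g k)
  | Coin n a b => Coin (mk n) (run mk th a k) (run mk th b k)
  end.

Fixpoint race n i j (TL TR : game R X) : game R X :=
  if n is m.+1 then
    Coin (mix n i j (entry TL) (entry TR))
      (run (fun a => mix m i.+1 j a (entry TR)) (V - i.+1%:R * D) TL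
           (fun T => race m i.+1 j T TR))
      (run (fun b => mix m i j.+1 (entry TL) b) (V - j.+1%:R * D) TR
           (fun T => race m i j.+1 TL T))
  else Move (mix 0 i j (entry TL) (entry TR))
         (if (i <= j)%N then gcat TL finL else gcat TR finR).

Lemma entry_race n i j TL TR :
  entry (race n i j TL TR) = mix n i j (entry TL) (entry TR).
Proof. by case: n. Qed.

Lemma entry_run mk th T k : (forall T, entry (k T) = mk (entry T)) ->
  entry (run mk th T k) = mk (entry T).
Proof. by move=> kmk; case: T => [n|n g|n a b] /=; case: ifP => _ //; rewrite kmk. Qed.

Let okL := node_ok d domL E.
Let okR := node_ok d domR E.

Lemma domLF x : domR x -> domL x = false.
Proof. by move=> xR; apply/negP => xL; apply: disj xL xR. Qed.

(** By [lead_skew] both branches have the same central value, so their potentials differ by at most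
    [2 * E + D + eta], and changing branch costs at least that. Inside a branch the lead terms
    cancel. *)
Lemma mix_psi n i j a b a' b' x y :
  okL a -> okR b -> okL a' -> okR b' ->
  on_track i a -> on_track j b -> on_track i a' -> on_track j b' ->
  (forall x y, cur a x -> cur a' y -> psi a x <= d x y + psi a' y) ->
  (forall x y, cur b x -> cur b' y -> psi b x <= d x y + psi b' y) ->
  cur a x || cur b x -> cur a' y || cur b' y ->
  psi (mix n i j a b) x <= d x y + psi (mix n i j a' b') y.
Proof.
move=> oa ob oa' ob' na nb na' nb' haa hbb; rewrite /on_track in na nb na' nb'.
have sk : lead n i j * D - lead n j i * D = i%:R * D - j%:R * D.
  by rewrite -!mulrBl lead_skew.
move=> /orP[ax|bx] /orP[ay|by_] /=.
- rewrite (node_dom oa ax) (node_dom oa' ay).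
  by have := haa _ _ ax ay; rlra.
- rewrite (node_dom oa ax) (domLF (node_dom ob' by_)).
  have := node_band oa ax; have := node_band ob' by_.
  by have := gapLR (node_dom oa ax) (node_dom ob' by_); rlra.
- rewrite (domLF (node_dom ob bx)) (node_dom oa' ay).
  have := node_band ob bx; have := node_band oa' ay.
  by have := gapRL (node_dom oa' ay) (node_dom ob bx); rlra.
- rewrite (domLF (node_dom ob bx)) (domLF (node_dom ob' by_)).
  by have := hbb _ _ bx by_; rlra.
Qed.

Lemma mix_ok n i j a b : okL a -> okR b -> on_track i a -> on_track j b ->
  node_ok d predT (E + D) (mix n i j a b).
Proof.
move=> oa ob na nb; split=> //.
- by have [x ax] := node_ex oa; exists x; rewrite /= ax.
- by move=> x y hx hy; apply: mix_psi => //; [exact: node_lip oa|exact: node_lip ob].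
- rewrite /on_track in na nb.
  have sk : lead n i j * D - lead n j i * D = i%:R * D - j%:R * D.
    by rewrite -!mulrBl lead_skew.
  move=> x /orP[ax|bx] /=.
    by rewrite (node_dom oa ax); have := node_band oa ax; rlra.
  by rewrite (domLF (node_dom ob bx)); have := node_band ob bx; rlra.
Qed.

(** A step lowers [lam] by at most [eta], so the piece stops within [eta] below [th]; it cannot run
    out before, since [G] puts the final nodes below [th]. *)
Lemma valid_run (dom : X -> bool) (G : node R X -> Prop) mk th T k :
  (forall T, entry (k T) = mk (entry T)) ->
  (forall n, G n -> lam n <= th) ->
  let good n := node_ok d dom E n /\ th - eta <= lam n <= th + D in
  (forall n, good n -> node_ok d predT (E + D) (mk n)) ->
  (forall n m, good n -> good m -> move_ok d gam eta n m ->
     move_ok d gam D (mk n) (mk m)) ->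
  (forall n a b, good n -> good a -> good b -> coin_ok eta n a b ->
     coin_ok D (mk n) (mk a) (mk b)) ->
  (forall T, valid d gam dom E eta G T -> th - eta <= lam (entry T) <= th ->
     valid d gam predT (E + D) D F (k T)) ->
  valid d gam dom E eta G T -> th - eta <= lam (entry T) <= th + D ->
  valid d gam predT (E + D) D F (run mk th T k).
Proof.
move=> kmk Gth good hn hm hc hk.
elim: T => [n|n g IH|n a IHa b IHb] /=.
- case=> nn Gn ln; case: ifP => _; apply: hk => //=; have := Gth n Gn; rlra.
- case=> nn mm vg ln; case: ifPn => [lth|]; first by apply: hk => //=; rlra.
  rewrite -ltNge => lth; have := move_lam mm => lg.
  have lg' : th - eta <= lam (entry g) <= th + D by rlra.
  split; [exact: hn| |exact: IH].
  by rewrite entry_run //; apply: hm => //; split=> //; exact: valid_entry vg.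
- case=> nn cc va vb ln; case: ifPn => [lth|]; first by apply: hk => //=; rlra.
  rewrite -ltNge => lth; have := coin_laml cc => la; have := coin_lamr cc => lb.
  have la' : th - eta <= lam (entry a) <= th + D by rlra.
  have lb' : th - eta <= lam (entry b) <= th + D by rlra.
  split; [exact: hn| |exact: IHa|exact: IHb].
  by rewrite !entry_run //; apply: hc => //; split=> //;
     [exact: valid_entry va|exact: valid_entry vb].
Qed.

(** Induction on the coins left. The bounds on [B] guarantee that either branch has enough left even
    if it wins all of them. *)
Lemma valid_race n i j TL TR :
  valid d gam domL E eta FL TL -> valid d gam domR E eta FR TR ->
  V - i%:R * D - eta <= lam (entry TL) <= V - i%:R * D ->
  V - j%:R * D - eta <= lam (entry TR) <= V - j%:R * D ->
  B <= V - (i + n)%:R * D -> B <= V - (j + n)%:R * D ->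
  valid d gam predT (E + D) D F (race n i j TL TR).
Proof.
have D0 : 0 <= D := le_trans eta0 etaD.
elim: n i j TL TR => [|n IH] i j TL TR vL vR lL lR Bi Bj.
  have oL := valid_entry vL; have oR := valid_entry vR.
  have nL : on_track i (entry TL) by rewrite /on_track; rlra.
  have nR : on_track j (entry TR) by rewrite /on_track; rlra.
  (* The branch that is behind survives. Its own lead is 0, so on it the mixed potential is just the
     potential of the branch. *)
  have [ij|ji] := leqP i j.
    have u0 : lead 0 i j = 0 :> R.
      by rewrite /=; case: leqP => // ji; rewrite (_ : i = j) ?subrr //;
         apply/eqP; rewrite eqn_leq ij ji.
    rewrite /race ij; split; [exact: mix_ok| |exact: finLP].
    rewrite entry_gcat; split.
    + move=> x y hx Ly; have := @mix_psi 0 i j _ _ _ _ x y oL oR oL oR nL nR nL nR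
         (node_lip oL) (node_lip oR) hx; rewrite Ly => /(_ isT).
      by rewrite [psi _ y]/= -/(lead 0 i j) (node_dom oL Ly) u0 mul0r addr0.
    + by move=> y Ly; exists y; rewrite ?dxx ?subrr //= Ly.
    + by rewrite [lam (mix _ _ _ _ _)]/= -/(lead 0 i j) u0; rlra.
  have u0 : lead 0 j i = 0 :> R by rewrite /= leqNgt ji.
  have u1 : lead 0 i j * D = i%:R * D - j%:R * D.
    by rewrite -mulrBl -(lead_skew 0) u0 subr0.
  rewrite /race leqNgt ji /=; split; [exact: mix_ok| |exact: finRP].
  rewrite entry_gcat; split.
  + move=> x y hx Ry; have := @mix_psi 0 i j _ _ _ _ x y oL oR oL oR nL nR nL nR
       (node_lip oL) (node_lip oR) hx; rewrite Ry orbT => /(_ isT).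
    by rewrite [psi _ y]/= -/(lead 0 j i) (domLF (node_dom oR Ry)) u0 mul0r addr0.
  + by move=> y Ry; exists y; rewrite ?dxx ?subrr //= Ry orbT.
  + by rewrite [lam (mix _ _ _ _ _)]/= -/(lead 0 i j) u1; rlra.
have oL := valid_entry vL; have oR := valid_entry vR.
have nL : on_track i (entry TL) by rewrite /on_track; rlra.
have nR : on_track j (entry TR) by rewrite /on_track; rlra.
rewrite -addSnnS in Bi; rewrite -addSnnS in Bj.
have Bi' : B <= V - (i + n)%:R * D by move: Bi; rewrite addSn -(natr1 (_ + n)%N); rlra.
have Bj' : B <= V - (j + n)%:R * D by move: Bj; rewrite addSn -(natr1 (_ + n)%N); rlra.
have BiS : B <= V - i.+1%:R * D.
  by have : 0 <= n%:R * D by [rewrite mulr_ge0]; move: Bi; rewrite natrD; rlra.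
have BjS : B <= V - j.+1%:R * D.
  by have : 0 <= n%:R * D by [rewrite mulr_ge0]; move: Bj; rewrite natrD; rlra.
have iS : i.+1%:R * D = i%:R * D + D by rewrite -(natr1 i); rlra.
have jS : j.+1%:R * D = j%:R * D + D by rewrite -(natr1 j); rlra.
rewrite /race -/race; set gl := run _ _ TL _; set gr := run _ _ TR _.
have rgl : entry gl = mix n i.+1 j (entry TL) (entry TR).
  by rewrite entry_run // => T; rewrite entry_race.
have rgr : entry gr = mix n i j.+1 (entry TL) (entry TR).
  by rewrite entry_run // => T; rewrite entry_race.
split; first exact: mix_ok.
(* The potential is the exact mean over the coin, by the recursion of [lead]; [lead_turn] bounds the
   change of [lam] by [D]. *)
- rewrite rgl rgr; split=> //.
  + by move=> x /= _; case: (domL x); rlra.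
  + have := @lead_turn R n i j.
    rewrite [lam (mix n.+1 _ _ _ _)]/= [lam _]/= iS; set P := lead n i.+1 j.
    set Q := lead n i j.+1 => /andP[QP PQ].
    have : Q * D <= P * D by exact: ler_wpM2r.
    have : P * D <= (Q + 2) * D by exact: ler_wpM2r.
    by lra.
  + have := @lead_turn R n i j.
    rewrite [lam (mix n.+1 _ _ _ _)]/= [lam _]/=; set P := lead n i.+1 j.
    set Q := lead n i j.+1 => /andP[QP PQ].
    have : Q * D <= P * D by exact: ler_wpM2r.
    have : P * D <= (Q + 2) * D by exact: ler_wpM2r.
    by lra.
- apply: (@valid_run domL FL) => //.
  + by move=> T; rewrite entry_race.
  + by move=> m /FLB ->.
  + by move=> m [om lm]; apply: mix_ok => //; rewrite /on_track; rlra.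
  + move=> m m' [om lm] [om' lm'] [p1 p2 p3]; split.
    * move=> x y hx hy; apply: (@mix_psi n i.+1 j) => //; rewrite ?/on_track; try rlra.
      exact: node_lip oR.
    * move=> y /orP[/p2[x mx dx]|Ry]; first by exists x; rewrite //= mx.
      by exists y; rewrite ?dxx ?subrr //= Ry orbT.
    * by rewrite /= lexx lerDl.
  + move=> m a b _ _ _ [c1 c2 c3 c4 c5]; split=> /=.
    * by move=> x; rewrite c1.
    * by move=> x; rewrite c2.
    * move=> x /orP[mx|Rx]; last by rewrite (domLF (node_dom oR Rx)); rlra.
      by have := c3 x mx; case: (domL x); rlra.
    * by rewrite lexx lerDl.
    * by rewrite lexx lerDl.
  + by move=> T vT lT; apply: IH => //; rlra.
  + rlra.
- apply: (@valid_run domR FR) => //.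
  + by move=> T; rewrite entry_race.
  + by move=> m /FRB ->.
  + by move=> m [om lm]; apply: mix_ok => //; rewrite /on_track; rlra.
  + move=> m m' [om lm] [om' lm'] [p1 p2 p3]; split.
    * move=> x y hx hy; apply: (@mix_psi n i j.+1) => //; rewrite ?/on_track; try rlra.
      exact: node_lip oL.
    * move=> y /orP[Ly|/p2[x mx dx]]; last by exists x; rewrite //= mx orbT.
      by exists y; rewrite ?dxx ?subrr //= Ly.
    * by rewrite /= lexx lerDl.
  + move=> m a b [om _] _ _ [c1 c2 c3 c4 c5]; split=> /=.
    * by move=> x; rewrite c1.
    * by move=> x; rewrite c2.
    * move=> x /orP[Lx|mx]; first by rewrite (node_dom oL Lx); rlra.
      by rewrite (domLF (node_dom om mx)); have := c3 x mx; rlra.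
    * by rewrite lexx lerDl.
    * by rewrite lexx lerDl.
  + by move=> T vT lT; apply: IH => //; rlra.
  + rlra.
Qed.

End Race.

(** * The spaces and their passes *)

Section Points.
Context {R : rcfType}.

Fixpoint pts k : finType :=
  if k is m.+1 then ('I_3 * bool * pts m)%type : finType else 'I_5.

Lemma card_pts k : #|pts k| = (5 * 6 ^ k)%N.
Proof.
elim: k => [|k IH] /=; first by rewrite card_ord.
by rewrite !card_prod IH card_ord card_bool expnS mulnCA.
Qed.

(* In the point [(c, b, x)] of level [k + 1], [c] is the third of the space, [b]
   the side and [x] a point of level [k]. The side only matters for the distance
   through [height], which vanishes at both ends of the space. *)
Definition len k : R := 4 * 3 ^+ k.

Fixpoint tau k : pts k -> R :=
  if k is m.+1 then fun x => x.1.1%:R * len m + tau x.2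
  else fun x : 'I_5 => x%:R.

Definition tent k (x : pts k) : R := Num.min (tau x) (len k - tau x).

Definition height m (x : pts m.+1) : R := if x.1.2 then tent x else - tent x.

(** With [tau], the heights at all levels are coordinates of a map to a space with the supremum
    norm, which makes [base] a pseudometric. *)
Fixpoint folds k : pts k -> pts k -> R :=
  if k is m.+1 then
    fun x y => Num.max `|height x - height y| (folds x.2 y.2)
  else fun _ _ => 0.

Definition base k (x y : pts k) : R := Num.max `|tau x - tau y| (folds x y).

(** The offline cost: 2 per step at level 0, one for the length and one for changing point, and 1 to
    enter the next third, hence [9 * 3 ^+ m] per third. *)
Fixpoint clock k : pts k -> R :=
  if k is m.+1 then fun x => x.1.1%:R * (9 * 3 ^+ m) + clock x.2
  else fun x : 'I_5 => 2 * x%:R.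

Fixpoint atstart k : pts k -> bool :=
  if k is m.+1 then fun x => (x.1.1 == 0) && atstart x.2
  else fun x : 'I_5 => x == 0.

Fixpoint atstop k : pts k -> bool :=
  if k is m.+1 then fun x => (x.1.1 == 2) && atstop x.2
  else fun x : 'I_5 => x == 4.

Lemma tauS m (x : pts m.+1) : tau x = x.1.1%:R * len m + tau x.2.
Proof. by []. Qed.

Lemma clockS m (x : pts m.+1) : clock x = x.1.1%:R * (9 * 3 ^+ m) + clock x.2.
Proof. by []. Qed.

Lemma pow3_gt0 k : 0 < 3 ^+ k :> R. Proof. exact: exprn_gt0. Qed.

Lemma ord3_le2 (c : 'I_3) : c%:R <= 2 :> R.
Proof. by rewrite (ler_nat _ _ 2) -ltnS. Qed.

Lemma val_ord3 : (nat_of_ord (0 : 'I_3) = 0%N) *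
  (nat_of_ord (1 : 'I_3) = 1%N) * (nat_of_ord (2 : 'I_3) = 2%N).
Proof. by []. Qed.

Lemma val_ord5 : nat_of_ord (4 : 'I_5) = 4%N. Proof. by []. Qed.

Lemma tau_ge0 k (x : pts k) : 0 <= tau x.
Proof.
elim: k x => [|k IH] x /=; first exact: ler0n.
by rewrite addr_ge0 // mulr_ge0 // /len mulr_ge0 // ltW // pow3_gt0.
Qed.

Lemma tau_le k (x : pts k) : tau x <= len k.
Proof.
elim: k x => [|k IH] x /=.
  by rewrite /len expr0 mulr1 (ler_nat _ _ 4) -ltnS.
have := IH x.2; have := ord3_le2 x.1.1; have := pow3_gt0 k.
rewrite /len exprS => p c2 h.
have : x.1.1%:R * (4 * 3 ^+ k) <= 2 * (4 * 3 ^+ k) :> R.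
  by rewrite ler_wpM2r //; lra.
by lra.
Qed.

Lemma tent_ge0 k (x : pts k) : 0 <= tent x.
Proof. by rewrite /tent le_min tau_ge0 subr_ge0 tau_le. Qed.

Lemma tent_lip k (x y : pts k) : `|tent x - tent y| <= `|tau x - tau y|.
Proof.
rewrite /tent; have := ler_norm (tau x - tau y); have := ler_norm (tau y - tau x).
rewrite (distrC (tau y)) ler_norml; set u := `|_|.
by case: (leP (tau x) (len k - tau x)); case: (leP (tau y) (len k - tau y)) => *; lra.
Qed.

Lemma height_lip m (x y : pts m.+1) : x.1.2 = y.1.2 ->
  `|height x - height y| <= `|tau x - tau y|.
Proof.
rewrite /height => ->; case: y.1.2; first exact: tent_lip.
by rewrite -opprD normrN tent_lip.
Qed.

Lemma folds_refl k (x : pts k) : folds x x = 0.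
Proof. by elim: k x => [|k IH] x //=; rewrite subrr normr0 IH maxxx. Qed.

Lemma folds_sym k (x y : pts k) : folds x y = folds y x.
Proof. by elim: k x y => [|k IH] x y //=; rewrite distrC IH. Qed.

Lemma max_tri (a b c a' b' c' : R) : a <= b + c -> a' <= b' + c' ->
  Num.max a a' <= Num.max b b' + Num.max c c'.
Proof.
by move=> h h'; rewrite ge_max; apply/andP; split;
  [apply: le_trans h _|apply: le_trans h' _]; rewrite lerD // le_max lexx ?orbT.
Qed.

Lemma folds_tri k (x y z : pts k) : folds x z <= folds x y + folds y z.
Proof.
elim: k x y z => [|k IH] x y z /=; first by rewrite addr0.
by apply: max_tri => //; exact: ler_distD.
Qed.

Lemma base_ge0 k (x y : pts k) : 0 <= base x y.
Proof. by rewrite /base le_max normr_ge0. Qed.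

Lemma base_refl k (x : pts k) : base x x = 0.
Proof. by rewrite /base subrr normr0 folds_refl maxxx. Qed.

Lemma base_sym k (x y : pts k) : base x y = base y x.
Proof. by rewrite /base distrC folds_sym. Qed.

Lemma base_tri k (x y z : pts k) : base x z <= base x y + base y z.
Proof. by apply: max_tri; [exact: ler_distD|exact: folds_tri]. Qed.

Lemma tau_start k (x : pts k) : atstart x -> tau x = 0.
Proof.
elim: k x => [|k IH] x /= => [/eqP -> //|/andP[/eqP -> /IH ->]].
by rewrite mul0r addr0.
Qed.

Lemma tau_stop k (x : pts k) : atstop x -> tau x = len k.
Proof.
elim: k x => [|k IH] x /=; first by move=> /eqP ->; rewrite /len expr0 mulr1.
by move=> /andP[/eqP -> /IH ->]; rewrite /len exprS val_ord3; lra.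
Qed.

Lemma clock_start k (x : pts k) : atstart x -> clock x = 0.
Proof.
elim: k x => [|k IH] x /=; first by move=> /eqP ->; rewrite mulr0.
by move=> /andP[/eqP -> /IH ->]; rewrite mul0r addr0.
Qed.

Lemma clock_stop k (x : pts k) : atstop x -> clock x = 9 * 3 ^+ k - 1.
Proof.
elim: k x => [|k IH] x /=; first by move=> /eqP ->; rewrite val_ord5 expr0; lra.
by move=> /andP[/eqP -> /IH ->]; rewrite exprS val_ord3; lra.
Qed.

Lemma tent_flat k (x : pts k) : atstart x || atstop x -> tent x = 0.
Proof.
rewrite /tent => /orP[/tau_start ->|/tau_stop ->]; rewrite ?subrr.
  by apply/min_idPl; rewrite subr0 /len mulr_ge0 // ltW // pow3_gt0.
by apply/min_idPr; rewrite /len mulr_ge0 // ltW // pow3_gt0.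
Qed.

Lemma folds_flat k (x y : pts k) :
  atstart x || atstop x -> atstart y || atstop y -> folds x y = 0.
Proof.
elim: k x y => [|k IH] x y // fx fy.
have h0 (z : pts k.+1) : atstart z || atstop z -> height z = 0.
  by move=> /tent_flat; rewrite /height => ->; case: ifP => // _; rewrite oppr0.
have f2 (z : pts k.+1) : atstart z || atstop z -> atstart z.2 || atstop z.2.
  by case/orP => /= /andP[_ ->]; rewrite ?orbT.
by rewrite /= !h0 // subrr normr0 IH ?f2 // maxxx.
Qed.

(* The term [y != z] separates points with the same image under [f]. *)
Definition ndist (Y : eqType) k (f : Y -> pts k) (y z : Y) : R :=
  (y != z)%:R + base (f y) (f z).

Definition pdist k := @ndist (pts k) k id.

Lemma ndist_ge0 (Y : eqType) k (f : Y -> pts k) y z : 0 <= ndist f y z.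
Proof. by rewrite addr_ge0 // base_ge0. Qed.

Lemma ndist_refl (Y : eqType) k (f : Y -> pts k) y : ndist f y y = 0.
Proof. by rewrite /ndist eqxx base_refl addr0. Qed.

Lemma ndist_sym (Y : eqType) k (f : Y -> pts k) y z : ndist f y z = ndist f z y.
Proof. by rewrite /ndist eq_sym base_sym. Qed.

Lemma ndist_pos (Y : eqType) k (f : Y -> pts k) y z : ndist f y z = 0 -> y = z.
Proof.
rewrite /ndist; case: eqVneq => //= _ h.
by exfalso; move: h (base_ge0 (f y) (f z)); lra.
Qed.

Lemma ndist_tri (Y : eqType) k (f : Y -> pts k) z y x :
  ndist f y x <= ndist f y z + ndist f z x.
Proof.
rewrite /ndist addrACA lerD ?base_tri // -natrD ler_nat.
by case: (eqVneq y z) => [->|_]; case: (eqVneq z x) => //= _; case: (_ == _).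
Qed.

Lemma pdist_down k (x y : pts k.+1) : x.1.1 = y.1.1 ->
  pdist x.2 y.2 <= pdist x y.
Proof.
move=> e; rewrite /pdist /ndist lerD //.
  by rewrite ler_nat; case: (eqVneq x y) => [->|_]; [rewrite eqxx|exact: leq_b1].
rewrite /base /= e ge_max !le_max; apply/andP; split; last by rewrite lexx !orbT.
by rewrite opprD addrACA subrr add0r lexx.
Qed.

(** The new coordinate [height] is 1-Lipschitz in [tau] on a fixed side, so it does not enlarge the
    maximum. *)
Lemma pdist_same k (x y : pts k.+1) : x.1 = y.1 -> pdist x y <= pdist x.2 y.2.
Proof.
move=> e; have et : tau x - tau y = tau x.2 - tau y.2.
  by rewrite /= e opprD addrACA subrr add0r.
rewrite /pdist /ndist lerD //.
  rewrite ler_nat; case: (eqVneq x.2 y.2) => [e2|_]; last exact: leq_b1.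
  by move: e e2; case: x {et} => x1 x2; case: y => y1 y2 /= -> ->; rewrite eqxx.
rewrite /base et /= !ge_max !le_max lexx /=; apply/andP; split.
  by rewrite (le_trans (height_lip _)) ?e // et lexx.
by rewrite lexx orbT.
Qed.

(** In the middle third [tent] is at least [4 * 3 ^+ k], and the two sides carry it with opposite
    signs. *)
Lemma pdist_gap k (x y : pts k.+1) : x.1.1 = 1 -> y.1.1 = 1 ->
  x.1.2 -> ~~ y.1.2 -> 8 * 3 ^+ k <= pdist x y.
Proof.
move=> x1 y1 xb yb; have ht (z : pts k.+1) : z.1.1 = 1 -> 4 * 3 ^+ k <= tent z.
  move=> z1; rewrite /tent le_min /= z1 /len exprS /= mul1r.
  by have := tau_ge0 z.2; have := tau_le z.2; rewrite /len; lra.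
have := ht x x1; have := ht y y1; rewrite /pdist /ndist /base /= /height xb (negbTE yb).
have hn : 0 <= (x != y)%:R :> R by [].
have := ler_norm (tent x - - tent y); set u := `|_ - - _| => h hy hx.
apply: le_trans (_ : u <= _); first by lra.
by rewrite -[leLHS]add0r lerD // !le_max lexx orbT.
Qed.

(** All lower heights vanish at the ends of a copy, so only the term that separates points
    remains. *)
Lemma pdist_bridge k (x y : pts k.+1) : tau x = tau y -> x.1.2 = y.1.2 ->
  atstop x.2 -> atstart y.2 -> pdist x y <= 1.
Proof.
move=> et eb sx sy; rewrite /pdist /ndist /base.
have -> : Num.max `|tau x - tau y| (folds x y) = 0.
  apply/eqP; rewrite eq_le le_max et subrr normr0 lexx andbT ge_max lexx /=.
  rewrite ge_max (le_trans (height_lip eb)) ?et ?subrr ?normr0 //=.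
  by rewrite folds_flat ?sx ?sy ?orbT.
by rewrite addr0 lern1 leq_b1.
Qed.

Lemma tent_le k (x : pts k) : 2 * tent x <= len k.
Proof. by rewrite /tent; case: (leP (tau x) (len k - tau x)); lra. Qed.

Lemma len_mono k : len k <= len k.+1.
Proof. by rewrite /len exprS; have := pow3_gt0 k; lra. Qed.

Lemma folds_le k (x y : pts k) : folds x y <= len k.
Proof.
elim: k x y => [|k IH] x y /=; first by rewrite /len mulr_ge0 // ltW // pow3_gt0.
rewrite ge_max (le_trans (IH _ _) (len_mono k)) andbT ler_norml /height.
have := tent_le x; have := tent_le y; have := tent_ge0 x; have := tent_ge0 y.
by case: ifP => _; case: ifP => _; lra.
Qed.

Lemma ndist_le (Y : eqType) k (f : Y -> pts k) x y : ndist f x y <= 1 + len k.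
Proof.
rewrite /ndist lerD ?lern1 ?leq_b1 // /base ge_max folds_le andbT ler_norml.
have := tau_ge0 (f x); have := tau_ge0 (f y).
by have := tau_le (f x); have := tau_le (f y); lra.
Qed.

End Points.

(** * Recursive construction of the passes *)

Section Passes.
Context {R : rcfType} (nf : nat -> nat).

Fixpoint worth k : R :=
  if k is m.+1 then 3 * worth m + lead (nf m) 0 0 * 3 ^+ m.+1 else 4.

Definition ended (X : Type) (z : R) (P : X -> bool) (n : node R X) :=
  [/\ lam n = z, exists x, cur n x & forall x, cur n x -> psi n x = z /\ P x].

Definition spot (i : 'I_5) : node R (pts 0) :=
  Node (fun x => x == i) (fun=> 4 - i%:R) (4 - i%:R).

Definition branch m (c : 'I_3) (b : bool) (y : pts m.+1) := y.1 == (c, b).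

Local Notation strand c b a g := (pull (branch c b) (fun y => y.2) a g).

(* The first third is crossed on both sides at once, with requests that do not
   distinguish the sides; the race takes place in the middle third, and the last
   third is crossed on the surviving side only. *)
Fixpoint pass k : game R (pts k) :=
  if k is m.+1 then
    gcat
      (pull (fun y : pts m.+1 => y.1.1 == 0) (fun y => y.2)
         (2 * worth m + lead (nf m) 0 0 * 3 ^+ m.+1) (pass m))
      (race (branch 1 true) (3 ^+ m.+1) (2 * worth m)
         (strand 2 true 0 (pass m)) (strand 2 false 0 (pass m)) (nf m) 0 0
         (strand 1 true (worth m) (pass m)) (strand 1 false (worth m) (pass m)))
  else
    Move (spot 0) (Move (spot 1) (Move (spot 2) (Move (spot 3) (Stop (spot 4))))).

(** The solution of [spread m.+1 = spread m + 3 ^+ m.+1] with value 0 at level 0: a race widens the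
    band by one piece. *)
Definition spread k : R := (3 ^+ k.+1 - 3) / 2.

Definition pass_ok k (g : game R (pts k)) :=
  [/\ valid (@pdist R k) (@clock R k) predT (spread k) (3 ^+ k)
        (ended 0 (@atstop k)) g
    , lam (entry g) = worth k
    & forall x, cur (entry g) x -> psi (entry g) x = worth k /\ atstart x].

Lemma pass0_ok : pass_ok (pass 0).
Proof.
have nok i : node_ok (@pdist R 0) predT (spread 0) (spot i).
  split=> //=; first by exists i; rewrite eqxx.
    by move=> x y _ _; rewrite lerDr ndist_ge0.
  by move=> x _; rewrite /spread expr1; lra.
have mok (i j : 'I_5) : j = i.+1 :> nat ->
    move_ok (@pdist R 0) (@clock R 0) (3 ^+ 0) (spot i) (spot j).
  move=> ij; have ne : i != j by rewrite -val_eqE /= ij neq_ltn ltnSn.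
  have dij : @pdist R 0 i j = 2.
    rewrite /pdist /ndist /base ne /= ij -(natr1 i) opprD addNKr normrN normr1.
    by rewrite (max_idPl _) // -natrD.
  split=> /=.
  - by move=> x y /eqP -> /eqP ->; rewrite dij ij -(natr1 i); lra.
  - move=> y /eqP ->; exists i; rewrite ?eqxx // dij /= ij -(natr1 i); lra.
  - by rewrite expr0 ij -(natr1 i); lra.
split.
- do 4! (split; [exact: nok|exact: mok|]); split; first exact: nok.
  split; first by apply/eqP; rewrite /= subr_eq0.
    by exists 4; exact: eqxx.
  by move=> x /eqP -> /=; split=> //; apply/eqP; rewrite subr_eq0.
- by rewrite /= subr0.
- by move=> x /= /eqP ->; rewrite subr0.
Qed.

Lemma valid_pull_snd m (dom : pts m.+1 -> bool) (a k E eta : R)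
    (F : node R (pts m) -> Prop) (F' : node R (pts m.+1) -> Prop) g (c : 'I_3) :
  (forall y, dom y -> y.1.1 = c) ->
  (forall y x, dom y -> dom (y.1, x)) -> (exists y, dom y) ->
  (forall n, F n -> F' (pulln dom (fun y => y.2) a n)) ->
  valid (@pdist R m) (@clock R m) predT E eta F g ->
  valid (@pdist R m.+1) (@clock R m.+1) dom E eta F' (pull dom (fun y => y.2) a g).
Proof.
move=> dc dx de sF; apply: (valid_pull (k := c%:R * (9 * 3 ^+ m))) => //.
- by move=> y z /dc yc /dc zc; apply: pdist_down; rewrite yc zc.
- by move=> y x yd; exists (y.1, x); [split=> //; exact: dx|exact: pdist_same].
- by move=> y /dc yc; rewrite /= yc addrC.
Qed.

Hypothesis nfP : forall k, (nf k)%:R * 3 ^+ k.+1 <= worth k.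

(** The shifts in [pass] are the costs to come after each third. The race runs from [2 * worth m]
    down to [worth m] at the lowest, as the last third is still due; [nfP] leaves room for all
    coins. *)
Lemma pass_valid k : pass_ok (pass k).
Proof.
elim: k => [|m [vg lg rg]]; first exact: pass0_ok.
have p3 : 0 < 3 ^+ m :> R := pow3_gt0 m.
have S3 : 3 ^+ m.+1 = 3 * 3 ^+ m :> R by rewrite exprS.
set D : R := 3 ^+ m.+1 in S3 *.
have ES : spread m.+1 = spread m + D by rewrite /spread exprS /D; lra.
have E0 : 0 <= spread m.
  rewrite /spread divr_ge0 // subr_ge0 -{1}(expr1 (3 : R)) ler_weXn2l //; lra.
have br c b (y : pts m.+1) : branch c b y -> y.1.1 = c by move=> /eqP ->.
have brS c b (y : pts m.+1) x : branch c b y -> branch c b ((y.1, x) : pts m.+1) by [].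
have [x0 _] := node_ex (valid_entry vg).
have brE c b : exists y : pts m.+1, branch c b y by exists ((c, b), x0); rewrite /branch eqxx.
have vp c b (a : R) : valid (@pdist R m.+1) (@clock R m.+1) (branch c b) (spread m)
    (3 ^+ m) (ended a (fun y : pts m.+1 => branch c b y && atstop y.2))
    (strand c b a (pass m)).
  apply: (@valid_pull_snd m _ _ 0 _ _ _ _ _ c _ _ _ _ vg) => //; first exact: br.
  move=> n [l0 [x nx] ne]; split=> /=; first by rewrite l0 add0r.
    by exists ((c, b), x); rewrite /branch eqxx.
  by move=> y /andP[yb /ne[-> ->]]; rewrite add0r yb.
have fin b T : valid (@pdist R m.+1) (@clock R m.+1) (branch 1 b) (spread m) (3 ^+ m)
      (ended (worth m) (fun y : pts m.+1 => branch 1 b y && atstop y.2)) T ->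
    valid (@pdist R m.+1) (@clock R m.+1) predT (spread m + D) D (ended 0 (@atstop m.+1))
      (gcat T (strand 2 b 0 (pass m))).
  move=> vT; apply: valid_gcat.
  - apply: (@valid_weaken _ _ _ _ _ _ _ _ _ _ _ _ _ _ _ _ (fun n h => h) vT) => //; lra.
  - apply: (valid_weaken _ _ _ _ (vp 2 b 0)); rewrite //; [lra|lra|].
    move=> n [h1 h2 h3]; split=> // x /h3[-> /andP[/eqP /= -> ->]]; by rewrite eqxx.
  - move=> n _ [ln [x nx] ne]; rewrite entry_pull; split.
    + move=> y z /ne[-> _] /= /andP[_ /rg[-> _]]; rewrite addr0 lerDr; exact: ndist_ge0.
    + move=> y /andP[/eqP yb /rg[_ sy]]; exists x; first exact: nx.
      have [_ /andP[/eqP xb sx]] := ne x nx.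
      apply: le_trans (pdist_bridge _ _ sx sy) _; rewrite ?xb ?yb //.
        by rewrite !tauS xb yb (tau_stop sx) (tau_start sy) !val_ord3 /len; lra.
      by rewrite !clockS xb yb (clock_stop sx) (clock_start sy) !val_ord3; lra.
    + by rewrite /= ln lg; lra.
pose rc := race (branch 1 true) D (2 * worth m)
  (strand 2 true 0 (pass m)) (strand 2 false 0 (pass m)) (nf m) 0 0
  (strand 1 true (worth m) (pass m)) (strand 1 false (worth m) (pass m)).
have vr : valid (@pdist R m.+1) (@clock R m.+1) predT (spread m + D) D
    (ended 0 (@atstop m.+1)) rc.
  have gp (x y : pts m.+1) : branch 1 true x -> branch 1 false y ->
      8 * 3 ^+ m <= pdist x y :> R.
    by move=> /eqP ex /eqP ey; apply: pdist_gap; rewrite ?ex ?ey.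
  apply: (@valid_race R _ (@pdist R m.+1) (@clock R m.+1) (branch 1 true)
    (branch 1 false) (spread m) (3 ^+ m) D (8 * 3 ^+ m) (2 * worth m) (worth m)
    (ended (worth m) (fun y : pts m.+1 => branch 1 true y && atstop y.2))
    (ended (worth m) (fun y : pts m.+1 => branch 1 false y && atstop y.2))).
  - by move=> x; rewrite /pdist ndist_refl.
  - by move=> x /eqP e; rewrite /branch e.
  - exact: gp.
  - by move=> x y hx hy; rewrite /pdist ndist_sym; exact: gp.
  (* Here [2 * E + D + eta] is [7 * 3 ^+ m - 3], below the gap [8 * 3 ^+ m]. *)
  - by rewrite /spread -/D; lra.
  - exact: E0.
  - exact: ltW p3.
  - lra.
  - by move=> n [].
  - by move=> n [].
  - exact: fin.
  - exact: fin.
  - exact: vp.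
  - exact: vp.
  - by rewrite entry_pull /= lg; lra.
  - by rewrite entry_pull /= lg; lra.
  - by have := nfP m; rewrite add0n -/D; lra.
  - by have := nfP m; rewrite add0n -/D; lra.
have rr x : cur (entry rc) x -> [/\ x.1.1 = 1, atstart x.2
    & psi (entry rc) x = 2 * worth m + lead (nf m) 0 0 * D].
  rewrite /rc entry_race !entry_pull /= => /orP[] /andP[xb /rg[-> ->]].
    by rewrite xb (br _ _ _ xb); split=> //; lra.
  by rewrite (br _ _ _ xb); split=> //; case: ifP => _; lra.
split.
- rewrite /pass -/pass -/D ES.
  pose P (y : pts m.+1) := (y.1.1 == 0) && atstop y.2.
  (* The first third must end on both sides, so that the offline server can enter whichever branch
     it wants. *)
  pose F n := ended (2 * worth m + lead (nf m) 0 0 * D) P n /\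
    forall b, exists x, cur n ((0, b), x).
  apply: (@valid_gcat _ _ _ _ _ _ _ F _ _ _ _ vr).
  + apply: (@valid_weaken _ _ _ _ (fun y => y.1.1 == 0) _ (spread m) _
      (3 ^+ m) _ F); rewrite //; [lra|lra|].
    apply: (@valid_pull_snd m _ _ 0 _ _ _ _ _ 0 _ _ _ _ vg) => //.
    * by move=> y /eqP.
    * by exists ((0, true), x0).
    * move=> n [l0 [x nx] ne]; split; last by move=> b; exists x; rewrite /= nx.
      split=> /=; first by rewrite l0 add0r.
        by exists ((0, true), x).
      by move=> y /andP[y0 /ne[-> sy]]; rewrite add0r /P y0 sy.
  + move=> n _ [[ln _ ne] nb]; split.
    * move=> x y /ne[-> _] /rr[_ _ ->].
      by rewrite lerDr; exact: ndist_ge0.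
    * move=> y /rr[y1 sy _]; have [x nx] := nb y.1.2.
      have [_ /andP[_ sx]] := ne _ nx.
      pose z : pts m.+1 := ((0, y.1.2), x); exists z => //.
      apply: le_trans (pdist_bridge (x := z) _ _ sx sy) _ => //.
        by rewrite !tauS y1 (tau_stop sx) (tau_start sy) /z /fst !val_ord3; lra.
      by rewrite !clockS y1 (clock_stop sx) (clock_start sy) /z /fst !val_ord3; lra.
    * by rewrite /rc entry_race /= ln; lra.
- by rewrite /pass -/pass entry_gcat entry_pull /= lg -/D; lra.
- move=> x; rewrite /pass -/pass entry_gcat entry_pull /= => /andP[-> /rg[-> ->]].
  by split=> //; rewrite -/D; lra.
Qed.
End Passes.

(** * Online and offline costs *)

Section Schedules.
Context {R : realType} {M : metricType R} (w : nat) (x0 : M).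
Implicit Types (x y : M) (s : seq M) (rho : seq (@request R M w)).

Lemma movement_cat x s t :
  movement x (s ++ t) = movement x s + movement (last x s) t.
Proof. by rewrite /movement pairmap_cat big_cat. Qed.

Lemma movement_cons x y s : movement x (y :: s) = mdist x y + movement y s.
Proof. by rewrite /movement /= big_cons. Qed.

Lemma movement_ge0 x s : 0 <= movement x s.
Proof.
elim: s x => [|y s IH] x; first by rewrite /movement big_nil.
by rewrite movement_cons addr_ge0 // mdist_ge0.
Qed.

Lemma serves_cat rho rho' s s' :
  serves rho s -> serves rho' s' -> serves (rho ++ rho') (s ++ s').
Proof.
elim: rho s => [|r rho IH] [|x s] //= /andP[xr srho] s'rho'.
by rewrite /serves /= xr; apply: IH.
Qed.

Lemma opt_cost_le rho s : serves rho s -> opt_cost x0 rho <= movement x0 s.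
Proof.
move=> sv; apply: ge_inf; last by exists s.
by exists 0 => _ [t _ <-]; exact: movement_ge0.
Qed.

Lemma opt_cost_ge0 rho : 0 <= opt_cost x0 rho.
Proof.
rewrite /opt_cost; set S := [set _ | _ in _].
(* By convention [inf] of the empty set is 0. *)
have [->|/set0P S0] := eqVneq S set0; first by rewrite inf0.
by apply: lb_le_inf => // _ [t _ <-]; exact: movement_ge0.
Qed.

Lemma last_trajectory (A : online_algorithm x0 w) rho :
  last x0 (trajectory A rho) = A rho.
Proof.
case/lastP: rho => [|rho r]; first by rewrite /trajectory position_nil.
rewrite /trajectory size_rcons -addn1 iotaD map_cat /= last_cat /=.
by rewrite add0n take_oversize // size_rcons.
Qed.

(** Being online, the algorithm does not revise earlier positions when a request is added. *)
Lemma alg_cost_rcons (A : online_algorithm x0 w) rho r :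
  alg_cost (rcons rho r) A = alg_cost rho A + mdist (A rho) (A (rcons rho r)).
Proof.
rewrite /alg_cost; have -> : trajectory A (rcons rho r) =
    trajectory A rho ++ [:: A (rcons rho r)].
  rewrite /trajectory size_rcons -addn1 iotaD map_cat /= add0n.
  rewrite take_oversize ?size_rcons //; congr (_ ++ _).
  apply/eq_in_map => i; rewrite mem_iota add0n => /andP[_ ir].
  by rewrite -cats1 takel_cat.
by rewrite movement_cat movement_cons last_trajectory /movement big_nil addr0.
Qed.

End Schedules.

(** * Random sequences against online and offline servers *)

Section Plays.
Context {R : realType} {M : metricType R} (w : nat) (x0 : M).
Context (dom : M -> bool) (req : (M -> bool) -> @request R M w).
Context (gam : M -> R) (E eta : R) (F : node R M -> Prop).
Implicit Types (g : game R M) (rho : seq (@request R M w)).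

Notation valid := (valid (@mdist R M) gam dom E eta F).

Definition demand g := req (cur (entry g)).

(** As a total function [req] may be wrong on some sets, for instance the empty one; [fit] says that
    it is right on the set asked for. *)
Definition fit (n : node R M) := forall x, (x \in val (req (cur n))) = cur n x.

Fixpoint fits g :=
  match g with
  | Stop n => fit n
  | Move n h => fit n /\ fits h
  | Coin n a b => [/\ fit n, fits a & fits b]
  end.

Lemma demandP g x : fits g -> (x \in val (demand g)) = cur (entry g) x.
Proof. by case: g => [n fg|n h [fg _]|n a b [fg _ _]]; exact: fg. Qed.

Lemma valid_fits g : (forall n, node_ok (@mdist R M) dom E n -> fit n) ->
  valid g -> fits g.
Proof.
move=> nf; elim: g => [n|n h IH|n a IHa b IHb] /=.
- by case=> /nf.
- by case=> /nf fn _ /IH.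
- by case=> /nf fn _ /IHa fa /IHb fb.
Qed.

(** The entry request of [g] is assumed to be in [rho] already; [loops] appends it. *)
Fixpoint avg g (f : seq (@request R M w) -> R) rho : R :=
  match g with
  | Stop _ => f rho
  | Move _ h => avg h f (rcons rho (demand h))
  | Coin _ a b => (avg a f rho + avg b f rho) / 2
  end.

Fixpoint play g rho : Prop :=
  match g with
  | Stop _ => rho = [::]
  | Move _ h => exists2 sig, rho = demand h :: sig & play h sig
  | Coin _ a b => play a rho \/ play b rho
  end.

(** Repetition makes the additive constant of the competitive ratio negligible. *)
Fixpoint loops m g (f : seq (@request R M w) -> R) rho : R :=
  if m is k.+1 then avg g (loops k g f) (rcons rho (demand g)) else f rho.

Lemma avg_mono g f f' rho : (forall sig, f sig <= f' sig) ->
  avg g f rho <= avg g f' rho.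
Proof.
move=> ff; elim: g rho => [n|n h IH|n a IHa b IHb] rho //=.
by have := IHa rho; have := IHb rho; lra.
Qed.

Lemma avg_addc g f c rho : avg g (fun sig => f sig + c) rho = avg g f rho + c.
Proof.
elim: g rho => [n|n h IH|n a IHa b IHb] rho //=.
by rewrite IHa IHb; lra.
Qed.

Lemma avg_le g f rho b :
  (forall sig, play g sig -> f (rho ++ sig) <= b) -> avg g f rho <= b.
Proof.
elim: g rho => [n|n h IH|n g IHg g' IHg'] rho /= hb.
- by have := hb [::] erefl; rewrite cats0.
- by apply: IH => sig ps; rewrite cat_rcons; apply: hb; exists sig.
- have := IHg rho (fun sig ps => hb sig (or_introl ps)).
  by have := IHg' rho (fun sig ps => hb sig (or_intror ps)); lra.
Qed.

(** Each move pays for the drop of [psi], coins do not lower its mean below its value, and it is at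
    most 0 at the end. *)
Lemma avg_ge (A : online_algorithm x0 w) g rho :
  (forall n x, F n -> cur n x -> psi n x <= 0) ->
  valid g -> fits g -> cur (entry g) (A rho) ->
  alg_cost rho A + psi (entry g) (A rho) <= avg g (fun sig => alg_cost sig A) rho.
Proof.
move=> F0; elim: g rho => [n|n h IH|n a IHa b IHb] rho /=.
- by case=> _ Fn _ /(F0 _ _ Fn); lra.
- case=> _ [mp _ _] vh [_ fh] nA.
  have hA : cur (entry h) (A (rcons rho (demand h))).
    by rewrite -demandP //; exact: position_rcons.
  have := IH _ vh fh hA; rewrite alg_cost_rcons; have := mp _ _ nA hA; lra.
- case=> _ [ca cb cp _ _] va vb [_ fa fb] nA.
  have aA : cur (entry a) (A rho) by rewrite ca.
  have bA : cur (entry b) (A rho) by rewrite cb.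
  by have := IHa _ va fa aA; have := IHb _ vb fb bA; have := cp _ nA; lra.
Qed.

(** Built from the end backwards with [move_reach], knowing all coins; the lengths telescope in
    [gam]. *)
Lemma play_schedule g rho top :
  (forall n x, F n -> cur n x -> gam x <= top) -> valid g -> fits g -> play g rho ->
  exists x s, [/\ cur (entry g) x, serves rho s & movement x s <= top - gam x].
Proof.
move=> Ft; elim: g rho => [n|n h IH|n a IHa b IHb] rho /=.
- case=> -[[x nx] _ _ _] Fn _ ->; exists x, [::]; split=> //.
  by rewrite /movement big_nil subr_ge0; exact: Ft Fn nx.
- case=> _ [_ mr _] vh [_ fh] [sig -> ps].
  have [y [s [hy sv ms]]] := IH _ vh fh ps; have [x nx dxy] := mr _ hy.
  exists x, (y :: s); split=> //; first by rewrite /serves /= demandP // hy.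
  by rewrite movement_cons; lra.
- case=> _ [ca cb _ _ _] va vb [_ fa fb] [pa|pb].
    by have [x [s [ax sv ms]]] := IHa _ va fa pa; exists x, s; rewrite -ca.
  by have [x [s [bx sv ms]]] := IHb _ vb fb pb; exists x, s; rewrite -cb.
Qed.

Section Loops.
Context (g : game R M) (bot top diam worth : R).
Hypothesis vg : valid g.
Hypothesis fg : fits g.
Hypothesis F0 : forall n x, F n -> cur n x -> psi n x <= 0.
Hypothesis Ftop : forall n x, F n -> cur n x -> gam x <= top.
Hypothesis entryP : forall x, cur (entry g) x -> worth <= psi (entry g) x /\ bot <= gam x.
Hypothesis diamP : forall x y : M, mdist x y <= diam.

Lemma loops_ge (A : online_algorithm x0 w) m rho :
  alg_cost rho A + m%:R * worth <= loops m g (fun sig => alg_cost sig A) rho.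
Proof.
elim: m rho => [|m IH] rho /=; first by rewrite mul0r addr0.
have gA : cur (entry g) (A (rcons rho (demand g))).
  by rewrite -demandP //; exact: position_rcons.
apply: le_trans (avg_mono _ _ IH); rewrite avg_addc.
have := avg_ge F0 vg fg gA; rewrite alg_cost_rcons; have [+ _] := entryP gA.
have := mdist_ge0 (A rho) (A (rcons rho (demand g))).
by rewrite -(natr1 m); lra.
Qed.

(** In each round the offline server returns to a start, within [diam], and then follows its
    schedule for [top - bot]. *)
Lemma loops_le (f : seq (@request R M w) -> R) C kappa m rho s b : 0 <= C ->
  (forall sig, f sig <= C * opt_cost x0 sig + kappa) ->
  serves rho s -> movement x0 s <= b ->
  loops m g f rho <= C * (b + m%:R * (top - bot + diam)) + kappa.
Proof.
move=> C0 fC; elim: m rho s b => [|m IH] rho s b sv mb.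
  rewrite /= mul0r addr0 (le_trans (fC _)) // lerD2r ler_wpM2l //.
  exact: le_trans (opt_cost_le x0 sv) mb.
rewrite /=; apply: avg_le => sig ps.
have [x [t [gx svt mt]]] := play_schedule Ftop vg fg ps.
rewrite cat_rcons; have [_ bx] := entryP gx.
have sv' : serves (rho ++ demand g :: sig) (s ++ x :: t).
  by apply: serves_cat => //; rewrite /serves /= demandP // gx.
have mv' : movement x0 (s ++ x :: t) <= b + (top - bot + diam).
  rewrite movement_cat movement_cons; have := diamP (last x0 s) x.
  by move: mb mt bx; lra.
apply: le_trans (IH _ _ _ sv' mv') _.
by rewrite -(natr1 m) lerD2r ler_wpM2l //; lra.
Qed.

End Loops.
End Plays.

(** * Measurability, and exchange of the two averages *)

Section Expectation.
Context {R : realType} {M : metricType R} (w : nat) (x0 : M).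
Context (req : (M -> bool) -> @request R M w) (pt : seq M).
Hypothesis pt_uniq : uniq pt.
Hypothesis pt_all : forall x : M, x \in pt.
Notation space := (@algorithm_space R M x0 w).
Context (P : randomized_algorithm x0 w).
Implicit Types (g : game R M) (rho : seq (@request R M w)).

Lemma measurable_decision rho (x : M) :
  measurable ([set A | position A rho = x] : set space).
Proof. by apply: sub_gen_smallest; exists rho, x. Qed.

(** As [M] is finite, the distance is a finite combination of products of indicators of decision
    events. *)
Lemma measurable_move rho rho' :
  measurable_fun [set: space]
    (fun A => mdist (position A rho) (position A rho') : R).
Proof.
have -> : (fun A => mdist (position A rho) (position A rho') : R) =
  (fun A : space => \sum_(x <- pt) \sum_(y <- pt) mdist x y *
     (\1_([set B | position B rho = x] : set space) A *
      \1_([set B | position B rho' = y] : set space) A)).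
  apply/funext => A; rewrite (bigD1_seq (position A rho)) //=.
  rewrite (bigD1_seq (position A rho')) //= !indicE !mem_set // !mulr1.
  rewrite !big1 ?addr0 // => y ny.
    by rewrite big1 // => z _; rewrite indicE memNset ?mul0r ?mulr0 //= => e;
       rewrite e eqxx in ny.
  rewrite !indicE [X in _ * (_ * X)](_ : _ = 0) ?mulr0 // memNset //= => e.
  by rewrite e eqxx in ny.
apply: measurable_sum => x; apply: measurable_sum => y.
apply: measurable_funM; first exact: measurable_cst.
by apply: measurable_funM; apply: measurable_indic; exact: measurable_decision.
Qed.

Lemma measurable_cost rho : measurable_fun [set: space] (@alg_cost R M x0 w rho).
Proof.
elim/last_ind: rho => [|rho r IH].
  have -> : @alg_cost R M x0 w [::] = cst 0.
    by apply/funext => A; rewrite /alg_cost /movement big_nil.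
  exact: measurable_cst.
have -> : @alg_cost R M x0 w (rcons rho r) = (fun A : space =>
    alg_cost rho A + mdist (position A rho) (position A (rcons rho r))).
  by apply/funext => A; rewrite alg_cost_rcons.
by apply: measurable_funD => //; exact: measurable_move.
Qed.

Definition averaged (h : space -> R) (e : R) :=
  [/\ measurable_fun [set: space] h, forall A, 0 <= h A & ('E_P[h] = e%:E)%E].

Lemma averaged_half h h' e e' : averaged h e -> averaged h' e' ->
  averaged (fun A => (h A + h' A) / 2) ((e + e') / 2).
Proof.
move=> [mh h0 Eh] [mh' h0' Eh']; split.
- by apply: measurable_funM; [exact: measurable_funD|exact: measurable_cst].
- by move=> A; rewrite divr_ge0 // addr_ge0.
- rewrite unlock; under eq_integral => A _ do rewrite mulrC EFinM.
  rewrite ge0_integralZl //; last 2 first.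
  + by apply/measurable_EFinP; exact: measurable_funD.
  + by move=> A _; rewrite lee_fin addr_ge0.
  under eq_integral => A _ do rewrite EFinD.
  rewrite ge0_integralD //; last 4 first.
  + by move=> A _; rewrite lee_fin.
  + exact/measurable_EFinP.
  + by move=> A _; rewrite lee_fin.
  + exact/measurable_EFinP.
  move: Eh Eh'; rewrite unlock => -> ->.
  by rewrite -EFinD -EFinM mulrC.
Qed.

(** The expectation over algorithms commutes with the finite average over coins, as in Yao's
    principle. *)
Lemma averaged_avg g (h : seq (@request R M w) -> space -> R) e rho :
  (forall sig, averaged (h sig) (e sig)) ->
  averaged (fun A => avg req g (h^~ A) rho) (avg req g e rho).
Proof.
move=> he; elim: g rho => [n|n k IH|n a IHa b IHb] rho /=; [exact: he|exact: IH|].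
exact: averaged_half.
Qed.

Lemma averaged_loops g (h : seq (@request R M w) -> space -> R) e m rho :
  (forall sig, averaged (h sig) (e sig)) ->
  averaged (fun A => loops req m g (h^~ A) rho) (loops req m g e rho).
Proof.
move=> he; elim: m rho => [|m IH] rho /=; first exact: he.
exact: averaged_avg.
Qed.

Lemma averaged_ge h e c : averaged h e -> 0 <= c -> (forall A, c <= h A) -> c <= e.
Proof.
move=> [mh h0 Eh] c0 ch; rewrite -lee_fin -Eh -(expectation_cst P c).
by apply: expectation_le => //; exact: aeW.
Qed.

Lemma averaged_cost C kappa : (forall rho,
    ('E_P[@alg_cost R M x0 w rho] <= (C * opt_cost x0 rho + kappa)%:E)%E) ->
  exists e, forall rho, averaged (@alg_cost R M x0 w rho) (e rho) /\
    e rho <= C * opt_cost x0 rho + kappa.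
Proof.
move=> comp; exists (fun rho => fine ('E_P[@alg_cost R M x0 w rho])%E) => rho.
have c0 A : 0 <= @alg_cost R M x0 w rho A by exact: movement_ge0.
have E0 := expectation_ge0 P c0; have := comp rho.
(* Nonnegative costs and the competitive bound make the expectation finite. *)
case Ee : ('E_P[@alg_cost R M x0 w rho])%E E0 => [e| |] //= _ ele.
by split; [split=> //; exact: measurable_cost|rewrite lee_fin in ele].
Qed.

End Expectation.

Section Ratio.
Context {R : realType} {M : metricType R} (w : nat) (x0 : M).
Context (req : (M -> bool) -> @request R M w) (pt : seq M) (dom : M -> bool).
Hypothesis pt_uniq : uniq pt.
Hypothesis pt_all : forall x : M, x \in pt.
Context (gam : M -> R) (E eta : R) (F : node R M -> Prop).
Context (g : game R M) (bot top diam worth : R).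
Hypothesis vg : valid (@mdist R M) gam dom E eta F g.
Hypothesis fg : fits req g.
Hypothesis F0 : forall n x, F n -> cur n x -> psi n x <= 0.
Hypothesis Ftop : forall n x, F n -> cur n x -> gam x <= top.
Hypothesis entryP : forall x, cur (entry g) x -> worth <= psi (entry g) x /\ bot <= gam x.
Hypothesis diamP : forall x y : M, mdist x y <= diam.
Hypothesis worth0 : 0 < worth.
Hypothesis per0 : 0 < top - bot + diam.

Lemma competitive_ge (P : randomized_algorithm x0 w) C :
  competitive P C -> worth / (top - bot + diam) <= C.
Proof.
case=> kappa comp; have [e ec] := averaged_cost pt_uniq pt_all comp.
have per_gt0 := per0; set per := top - bot + diam in per_gt0 *.
(* [loops_le] asks for a nonnegative ratio; [worth0] brings back [C] at the end. *)
set C' := Num.max C 0.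
have C'0 : 0 <= C' by rewrite le_max lexx orbT.
have key m : m%:R * worth <= C' * (m%:R * per) + kappa.
  have av := averaged_loops req g m [::] (fun sig => (ec sig).1).
  apply: (le_trans (averaged_ge (c := m%:R * worth) av _ _)).
  - by rewrite mulr_ge0 // ltW.
  - move=> A; have := loops_ge vg fg F0 entryP A m [::].
    by rewrite /alg_cost /movement big_nil add0r.
  have := @loops_le _ _ w x0 dom req gam E eta F g bot top diam worth vg fg Ftop
     entryP diamP e C' kappa m [::] [::] 0 C'0.
  rewrite add0r; apply=> //; last by rewrite /movement big_nil.
  move=> sig; apply: le_trans (ec sig).2 _; rewrite lerD2r ler_wpM2r //.
    exact: opt_cost_ge0.
  by rewrite le_max lexx.
have wC' : worth <= C' * per.
  (* Otherwise every round gains a fixed amount, and enough rounds exceed [kappa]. *)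
  rewrite leNgt; apply/negP; rewrite -subr_gt0 => lt.
  have := archi_boundP (divr_ge0 (normr_ge0 kappa) (ltW lt)).
  rewrite ltr_pdivrMr //; set m := Num.bound _.
  by have := key m; have := ler_norm kappa; lra.
rewrite ler_pdivrMr //; move: wC'; rewrite /C'; case: (leP C 0) => // _.
by rewrite mul0r leNgt worth0.
Qed.
End Ratio.

(** * Lower bounds *)

Section Growth.
Context {R : realType}.

(** This is [worth] divided by [3 ^+ k], with as many coins as [flips_le] permits. *)
Fixpoint rate k : R :=
  if k is m.+1 then rate m + lead (Num.truncn (rate m / 3)) 0 0 else 4.

Definition flips k := Num.truncn (rate k / 3).

Lemma worth_rate k : worth flips k = rate k * 3 ^+ k.
Proof.
elim: k => [|k IH] /=; first by rewrite mulr1.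
by rewrite IH exprS; lra.
Qed.

Lemma lead_ge0 n : 0 <= lead n 0 0 :> R.
Proof.
have [->|n0] := posnP n; first by rewrite /= subrr.
have t0 : 0 < Num.sqrt (3 * n%:R) :> R by rewrite sqrtr_gt0 mulr_gt0 ?ltr0n.
have := lead_sqrt t0; rewrite sqr_sqrtr ?mulr_ge0 // => /(_ n erefl); lra.
Qed.

Lemma rate_ge4 k : 4 <= rate k.
Proof. by elim: k => [|k IH] //=; have := lead_ge0 (Num.truncn (rate k / 3)); lra. Qed.

Lemma flips_le k : (flips k)%:R * 3 ^+ k.+1 <= worth flips k :> R.
Proof.
rewrite worth_rate exprS mulrA ler_wpM2r ?exprn_ge0 // -ler_pdivlMr //.
by rewrite truncn_le // divr_ge0 //; have := rate_ge4 k; lra.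
Qed.

(** A level adds at least [sqrt (rate k) / 16], so the square root of the rate grows by at least
    [1 / 40]. *)
Lemma rate_quadratic k : ((k.+2)%:R / 40) ^+ 2 <= rate k.
Proof.
elim: k => [|k IH] /=; first by rewrite expr2; lra.
have r4 := rate_ge4 k; set n := Num.truncn _.
have r3 : 0 <= rate k / 3 by lra.
have n1 : rate k / 3 < n.+1%:R by rewrite truncnS_gt.
have nr : rate k / 4 <= 3 * n%:R by move: n1; rewrite -(natr1 n); lra.
pose s := Num.sqrt (rate k); pose t : R := Num.sqrt (3 * n%:R).
have ss : s ^+ 2 = rate k by rewrite sqr_sqrtr //; lra.
have tt : t ^+ 2 = 3 * n%:R by rewrite sqr_sqrtr //; lra.
have s0 : 0 < s by rewrite sqrtr_gt0; lra.
have t0 : 0 < t by rewrite sqrtr_gt0; lra.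
have st : s / 2 <= t.
  rewrite -(@ler_pXn2r _ 2) ?nnegrE ?ltW ?divr_gt0 //.
  by rewrite tt expr_div_n ss; lra.
have lt := lead_sqrt t0 tt.
have zs : k.+2%:R / 40 <= s.
  by rewrite -(@ler_pXn2r _ 2) ?nnegrE ?ss // ?ltW // divr_ge0.
have s1 : 1 <= s.
  by rewrite -(@ler_pXn2r _ 2) ?nnegrE ?ss ?expr1n // ?ltW //; lra.
(* The square is [s ^ 2 + s / 20 + 1 / 1600], at most [s ^ 2 + s / 16] as [s >= 1]. *)
apply: le_trans (_ : (s + 1 / 40) ^+ 2 <= _).
  rewrite ler_pXn2r ?nnegrE ?divr_ge0 //; last by lra.
  by move: zs; rewrite -(natr1 k.+2); lra.
by rewrite -ss; lra.
Qed.
End Growth.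

(** The alias keeps [f] in the type, so that the metric can depend on it. Since [ndist] separates
    equal labels, any [n] is possible. *)
Definition folded k n (f : 'I_n -> pts k) := 'I_n.

Section FoldedSpace.
Context {R : realType} (k n : nat) (f : 'I_n -> pts k).

HB.instance Definition _ := Choice.copy (folded f) 'I_n.
HB.instance Definition _ := @isMetric.Build R (folded f) (@ndist R _ k f)
  (ndist_refl f) (@ndist_pos R _ k f) (ndist_sym f) (@ndist_tri R _ k f).

Definition space : metricType R := folded f.

Lemma card_space : ([set: space] #= `I_n)%card.
Proof. by rewrite card_eq_sym; exact: card_II. Qed.

Lemma mdist_space (x y : space) : mdist x y = ndist f x y. Proof. by []. Qed.

Lemma set_request (w : nat) (S : space -> bool) : (exists x, S x) ->
  (#|[pred x : 'I_n | S x]| <= w)%N ->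
  exists r : @request R space w, forall x, (x \in val r) = S x.
Proof.
move=> [p Sp] Sw; pose r : {fset space} := [fset x in [seq x <- enum 'I_n | S x]]%fset.
have rS x : (x \in r) = S x.
  by rewrite inE /= mem_filter (mem_enum 'I_n x) andbT.
have rP : (r != fset0)%fset && (#|` r|%fset <= w)%N.
  apply/andP; split; first by apply/fset0Pn; exists p; rewrite rS.
  rewrite /r card_fseq; apply: leq_trans (size_undup _) _.
  rewrite (leq_trans _ Sw) // cardE eq_leq //; congr size.
  by rewrite enumT /enum_mem; apply: eq_filter.
by exists (exist _ r rP).
Qed.

End FoldedSpace.
Arguments space : clear implicits.

(** * Uniform spaces, for few points *)

Section SmallSpaces.
Context {R : realType} (n : nat).
Notation M := (space R 0 n.+2 (fun=> 0)).
Implicit Types x y : M.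

Definition hop : game R M :=
  Move (Node (fun x => x == ord0) (fun=> 1) 1)
    (Stop (Node (fun x => x == ord_max) (fun=> 0) 0)).

(** Two points at distance 1 are requested in turn: a round forces cost 1 and is charged 1 plus the
    diameter 1 offline. *)
Lemma hop_ratio (x0 : M) C (P : randomized_algorithm x0 n.+1) :
  competitive P C -> 1 / 2 <= C.
Proof.
have one (p : M) : exists r : @request R M n.+1, forall x, (x \in val r) = (x == p).
  apply: set_request; first by exists p.
  by rewrite (eq_card (B := pred1 (p : 'I_n.+2))) ?card1.
have [r0 r0P] := one ord0; have [r1 r1P] := one ord_max.
pose req (S : M -> bool) := if S ord0 then r0 else r1.
have d1 : mdist (ord0 : M) ord_max = 1.
  by rewrite mdist_space /ndist base_refl addr0.
have -> : 1 / 2 = 1 / (1 - 0 + 1) :> R by rewrite subr0.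
apply: (@competitive_ge R M n.+1 x0 req (enum 'I_n.+2) predT _ _
   (fun x => (x == ord_max)%:R) 0 1 (fun n => n = Node (fun x => x == ord_max) (fun=> 0) 0)
   hop 0 1 1 1).
- exact: enum_uniq.
- by move=> x; rewrite (mem_enum 'I_n.+2 x).
- have near0 p (c : R) : node_ok (@mdist R M) predT 0 (Node (fun x => x == p) (fun=> c) c).
    split=> //=; [by exists p|by move=> x y _ _; rewrite lerDr mdist_ge0|].
    by move=> x _; rewrite subr0 addr0 lexx.
  split; [exact: near0| |by split; [exact: near0|]].
  split=> /=.
  + by move=> x y /eqP -> /eqP ->; rewrite d1 addr0.
  + by move=> y /eqP ->; exists ord0; rewrite ?d1 ?eqxx //= subr0.
  + by rewrite ler01 add0r lexx.
- by split=> x; rewrite /req /=; [exact: r0P|exact: r1P].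
- by move=> m x -> _ /=.
- by move=> m x _ _; rewrite lern1 leq_b1.
- by move=> x _; rewrite ler0n.
- by move=> x y; rewrite mdist_space /ndist base_refl addr0 lern1 leq_b1.
- exact: ltr01.
- by rewrite subr0 addr_gt0.
Qed.
End SmallSpaces.

(** * Passes in a space with an arbitrary large number of points *)

Section LargeSpaces.
Context {R : realType} (h n : nat).
Hypothesis hn : (5 * 6 ^ h < n)%N.

Fixpoint origin k : pts k :=
  if k is m.+1 then ((0, true), origin m) else 0.

(** Indices beyond the enumeration get the default [origin h]; the pass never requests them. *)
Definition label (i : 'I_n) : pts h := nth (origin h) (enum (pts h)) i.

Notation M := (space R h n label).

Definition labelled (i : M) := ((i : 'I_n) < 5 * 6 ^ h)%N.

Lemma label_inj (i j : M) : labelled i -> labelled j -> label i = label j -> i = j.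
Proof.
move=> li lj /eqP; rewrite nth_uniq ?enum_uniq -?cardE ?card_pts //.
by move=> /eqP/val_inj.
Qed.

Lemma label_onto (x : pts h) : exists2 i : M, labelled i & label i = x.
Proof.
have xh : (index x (enum (pts h)) < 5 * 6 ^ h)%N.
  by rewrite -card_pts cardE index_mem mem_enum.
exists (Ordinal (ltn_trans xh hn)) => //.
by rewrite /label /= nth_index // mem_enum.
Qed.

Definition long_pass : game R M := pull labelled label 0 (pass (@flips R) h).

Lemma long_pass_valid : valid (@mdist R M) (fun i => clock (label i)) labelled
  (spread h) (3 ^+ h) (ended 0 (fun i => atstop (label i))) long_pass.
Proof.
have [vp _ _] := pass_valid (@flips_le R) h.
apply: (valid_pull (k := 0) _ _ _ _ _ vp).
- move=> i j _ _; rewrite mdist_space /pdist /ndist lerD2r ler_nat.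
  by case: (eqVneq i j) => [->|_]; [rewrite eqxx|exact: leq_b1].
- move=> j x lj; have [i li <-] := label_onto x; exists i => //.
  rewrite mdist_space /pdist /ndist lerD2r ler_nat.
  by case: (eqVneq (label i)) => [/(label_inj li lj) ->|_]; [rewrite eqxx|exact: leq_b1].
- by have [i] := label_onto (origin h); exists i.
- by move=> i _; rewrite addr0.
- move=> m [l0 [x mx] me]; split=> /=; first by rewrite l0 addr0.
    by have [i li lx] := label_onto x; exists i; rewrite li lx.
  by move=> i /andP[_ /me[-> ->]]; rewrite addr0.
Qed.

Lemma long_pass_ratio (x0 : M) C (P : randomized_algorithm x0 n.-1) :
  competitive P C -> rate h / 13 <= C.
Proof.
have n0 : (0 < n)%N by exact: leq_ltn_trans hn.
have [_ _ rp] := pass_valid (@flips_le R) h.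
have fitS (S : M -> bool) : exists r : @request R M n.-1,
    (exists x, S x) /\ (forall x, S x -> labelled x) ->
    forall x, (x \in val r) = S x.
  have mk (S' : M -> bool) : (exists x, S' x) -> (forall x, S' x -> labelled x) ->
      exists r : @request R M n.-1, forall x, (x \in val r) = S' x.
    move=> e l; apply: set_request => //.
    (* The point of index [5 * 6 ^ h] is not labelled, so labelled sets have at most [n - 1]
       points. *)
    rewrite -[n in n.-1]card_ord -(cardC1 (Ordinal hn)) subset_leq_card //.
    apply/fintype.subsetP => i /l; rewrite !inE /labelled.
    by apply: contraTneq => ->; rewrite -leqNgt.
  case: (pselect ((exists x, S x) /\ (forall x, S x -> labelled x))) => [[e l]|nS].
    by have [r rS] := mk S e l; exists r.
  have [i li _] := label_onto (origin h).
  have [r _] := mk labelled (ex_intro _ i li) (fun _ h => h).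
  by exists r.
have [req reqP] := choice fitS.
have p3 : 0 < 3 ^+ h :> R := pow3_gt0 h.
have -> : rate h / 13 = (rate h * 3 ^+ h) / (9 * 3 ^+ h - 1 - 0 + (1 + len h)) :> R.
  (* A pass costs [9 * 3 ^+ h - 1] offline and the return at most [1 + 4 * 3 ^+ h]. *)
  rewrite [X in _ = _ / X](_ : _ = 13 * 3 ^+ h); last by rewrite /len; lra.
  by rewrite -mulf_div divff ?mulr1 // gt_eqF.
apply: (@competitive_ge R M n.-1 x0 req (enum 'I_n) labelled _ _
   (fun i => clock (label i)) (spread h) (3 ^+ h) (ended 0 (fun i => atstop (label i)))
   long_pass).
- exact: enum_uniq.
- by move=> x; rewrite (mem_enum 'I_n x).
- exact: long_pass_valid.
- apply: valid_fits long_pass_valid => m om x; apply: reqP.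
  by split; [exact: node_ex om|exact: node_dom om].
- by move=> m x [_ _ me] /me[-> _].
- by move=> m x [_ _ me] /me[_ /clock_stop ->].
- move=> x; rewrite entry_pull /= => /andP[_ /rp[-> /clock_start ->]].
  by rewrite addr0 worth_rate.
- by move=> x y; rewrite mdist_space; exact: ndist_le.
- by rewrite mulr_gt0 //; have := @rate_ge4 R h; lra.
- rewrite /len; lra.
Qed.
End LargeSpaces.

Lemma level_exists n : (5 < n)%N -> exists2 h, (5 * 6 ^ h < n)%N & (n <= 5 * 6 ^ h.+1)%N.
Proof.
move=> n5; pose P h := (5 * 6 ^ h < n)%N.
have ex : exists h, P h by exists 0%N; rewrite /P expn0 muln1.
have ub h : P h -> (h <= n)%N.
  move=> Ph; apply: leq_trans (ltnW Ph).
  by apply: leq_trans (ltnW (ltn_expl h (isT : (1 < 6)%N))) _; rewrite leq_pmull.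
case: (ex_maxnP ex ub) => h Ph hmax; exists h => //.
by rewrite leqNgt; apply/negP => /hmax; rewrite ltnn.
Qed.

Theorem theorem2 (R : realType) :
  exists c : R, 0 < c /\
    forall n : nat, (2 <= n)%N ->
      exists M : metricType R, ([set: M] #= `I_n)%card /\
        forall x0 : M, ((c * ln n%:R ^+ 2)%:E <= C_rand_MSS x0 n.-1)%E.
Proof.
(* Few points need [25 c <= 1 / 2]; many need [36 c <= 1 / (13 * 1600)], from [ln n <= 6 (h + 2)]
   and [rate_quadratic]. *)
exists (1 / 100 * (1 / 100) * (1 / 100)); split; first by rewrite !mulr_gt0.
move=> n n2.
have lnn0 : 0 <= ln n%:R :> R by rewrite ln_ge0 // ler1n ltnW.
have [n5|n6] := leqP n 5.
  case: n n2 n5 lnn0 => [|[|n]] // _ n5 lnn0.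
  exists (space R 0 n.+2 (fun=> 0)); split; first exact: card_space.
  move=> x0; apply: le_ereal_inf_tmp => _ [C [P cP] <-]; rewrite lee_fin.
  apply: le_trans (hop_ratio cP).
  have l5 : ln n.+2%:R <= 5 :> R.
    have n5' : n.+2%:R <= 5 :> R by rewrite (ler_nat _ _ 5).
    by have := @ln_sublinear R n.+2%:R; rewrite ltr0n => /(_ isT); lra.
  have : ln n.+2%:R ^+ 2 <= 5 ^+ 2 :> R by rewrite ler_pXn2r ?nnegrE.
  by lra.
have [h hn nh] := level_exists n6.
exists (space R h n (@label h n)); split; first exact: card_space.
move=> x0; apply: le_ereal_inf_tmp => _ [C [P cP] <-]; rewrite lee_fin.
apply: le_trans (long_pass_ratio hn cP).
have ln6 : ln n%:R <= 6 * h.+2%:R :> R.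
  have l6 : ln 6 <= 6 :> R by rewrite ltW // ln_sublinear.
  apply: le_trans (_ : ln ((6 ^ h.+2)%:R) <= _).
    rewrite ler_ln ?posrE ?ltr0n ?expn_gt0 ?(ltnW n2) // ler_nat (leq_trans nh) //.
    by rewrite [leqRHS]expnS leq_mul2r orbT.
  by rewrite natrX lnXn // -[ln _ *+ _]mulr_natr ler_wpM2r.
have : ln n%:R ^+ 2 <= (6 * h.+2%:R) ^+ 2 :> R by rewrite ler_pXn2r ?nnegrE ?mulr_ge0.
have := @rate_quadratic R h; rewrite !exprMn; set z := h.+2%:R ^+ 2.
have : 0 <= z by rewrite sqr_ge0.
by lra.
Qed.
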